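(* For every $n\in\mathbb{Z}_{>0}$, let $\boldsymbol{\sigma}^n$ be a uniform random $231$-avoiding permutation of size $n$. Then, for all $\pi\in\mathrm{Av}(231)$, we have the following convergence in probability as $n\to\infty$: $$\widetilde{\mathrm{c\text{-}occ}}(\pi,\boldsymbol{\sigma}^n)\xrightarrow{P}\frac{2^{\mathrm{LRMax}(\pi)+\mathrm{RLMax}(\pi)}}{2^{2|\pi|}},$$ where $\mathrm{LRMax}(\pi)$ (resp. $\mathrm{RLMax}(\pi)$) denotes the number of left-to-right maxima (resp. right-to-left maxima) of $\pi$.
   Context: $\mathcal{S}^n$ is the set of permutations $\sigma=\sigma_1\cdots\sigma_n$ of $[n]=\{1,\dots,n\}$, with size $|\sigma|=n$. For $I\subseteq[n]$, $\mathrm{pat}_I(\sigma)$ is the permutation of size $|I|$ in the same relative order as $(\sigma_i)_{i\in I}$. The permutation $\sigma$ avoids $\rho$ if there is no subset $I\subseteq[n]$ (not necessarily an interval) with $\mathrm{pat}_I(\sigma)=\rho$; $\mathrm{Av}^n(\rho)$ is the set of $\rho$-avoiding permutations of size $n$ and $\mathrm{Av}(\rho)=\bigcup_{n\ge1}\mathrm{Av}^n(\rho)$. $\mathrm{c\text{-}occ}(\pi,\sigma)$ is the number of integer intervals $I\subseteq[n]$ with $|I|=|\pi|$ and $\mathrm{pat}_I(\sigma)=\pi$, and $\widetilde{\mathrm{c\text{-}occ}}(\pi,\sigma)=\mathrm{c\text{-}occ}(\pi,\sigma)/n$ where $n=|\sigma|$. An index $i$ is a left-to-right maximum of $\pi$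 if $\pi_j<\pi_i$ for every $j<i$, and a right-to-left maximum if $\pi_i>\pi_j$ for every $j>i$. *)

(* Defs.v *)
From HB Require Import structures.
From mathcomp Require Import all_boot all_order all_algebra all_fingroup.
From mathcomp Require Import all_classical all_reals all_analysis.

Set Implicit Arguments.
Unset Strict Implicit.
Unset Printing Implicit Defensive.

Import Order.TTheory GRing.Theory Num.Theory.
Import numFieldNormedType.Exports.

(* A permutation of size n is an element of 'S_n; indices and values are      *)
(* shifted by one, ranging over 'I_n = {0, ..., n - 1}.                       *)

Section Pattern.
Variables (n : nat) (I : {set 'I_n}) (s : 'S_n).

(* Rank of the value s_i, for i the a-th smallest index in I, among the       *)
(* values (s_j) with j in I. Note that enum_val is increasing here.           *)
Definition pat_rank (a : 'I_#|I|) : nat :=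
  #|[set j in I | s j < s (enum_val a)]|.

Lemma pat_rank_lt a : pat_rank a < #|I|.
Proof.
apply: proper_card; apply/properP; split.
  by apply/fintype.subsetP => j; rewrite inE => /andP[].
by exists (enum_val a); [exact: enum_valP | rewrite inE ltnn andbF].
Qed.

Lemma pat_rank_mono a b :
  (pat_rank a < pat_rank b) = (s (enum_val a) < s (enum_val b)).
Proof.
have le c e : s (enum_val c) <= s (enum_val e) -> pat_rank c <= pat_rank e.
  move=> ce; apply/subset_leq_card/fintype.subsetP => j; rewrite !inE.
  by case/andP=> -> /= jc; exact: leq_trans jc ce.
have [ab|/le ba] := ltnP (s (enum_val a)); last by rewrite ltnNge ba.
apply: proper_card; apply/properP; split.
  apply/fintype.subsetP => j; rewrite !inE => /andP[-> /= ja].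
  exact: ltn_trans ja ab.
by exists (enum_val a); rewrite inE ?enum_valP ?ltnn.
Qed.

Definition pat_fun (a : 'I_#|I|) : 'I_#|I| := Ordinal (pat_rank_lt a).

Lemma pat_fun_inj : injective pat_fun.
Proof.
move=> a b /(congr1 val) /= eab; apply/enum_val_inj/(@perm_inj _ s)/val_inj.
case: (ltngtP (s (enum_val a)) (s (enum_val b))) => //;
  by rewrite -pat_rank_mono eab ltnn.
Qed.

Definition pat : 'S_#|I| := perm pat_fun_inj.

Lemma pat_mono a b : (pat a < pat b) = (s (enum_val a) < s (enum_val b)).
Proof. by rewrite !permE pat_rank_mono. Qed.

End Pattern.

(* Equality between permutations whose sizes are not syntactically equal.     *)
Definition same_perm m k (p : 'S_m) (q : 'S_k) : bool :=
  Tagged (fun l => 'S_l) p == Tagged (fun l => 'S_l) q.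

Definition avoids n k (s : 'S_n) (r : 'S_k) : bool :=
  ~~ [exists I : {set 'I_n}, same_perm (pat I s) r].

Definition Av n k (r : 'S_k) : {set 'S_n} := [set s | avoids s r].

Definition int_interval n (I : {set 'I_n}) : bool :=
  [forall i in I, forall j in I, forall l : 'I_n, (i <= l <= j) ==> (l \in I)].

Definition cocc k n (p : 'S_k) (s : 'S_n) : nat :=
  #|[set I : {set 'I_n} |
      [&& int_interval I, #|I| == k & same_perm (pat I s) p]]|.

Definition LRMax n (p : 'S_n) : nat :=
  #|[set i : 'I_n | [forall j : 'I_n, (j < i) ==> (p j < p i)]]|.

Definition RLMax n (p : 'S_n) : nat :=
  #|[set i : 'I_n | [forall j : 'I_n, (i < j) ==> (p j < p i)]]|.

(* ordS is i |-> i + 1 modulo 3, i.e., the one-line word 1 2 0.               *)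
Definition perm231 : 'S_3 := perm (@ordS_inj 3).

Local Open Scope classical_set_scope.
Local Open Scope ring_scope.

Definition cocc_freq (R : realType) k n (p : 'S_k) (s : 'S_n) : R :=
  (cocc p s)%:R / n%:R.

(* The discrete sigma-algebra on permutations.                                *)
HB.instance Definition _ (T : finType) := isPointed.Build (perm_type T) 1%g.
HB.instance Definition _ (T : finType) :=
  @isMeasurable.Build default_measure_display (perm_type T)
    discrete_measurable discrete_measurable0
    discrete_measurableC discrete_measurableU.

Definition uniform_on (R : realType) (d : measure_display)
    (T : measurableType d) (P : probability T R) n
    (X : {RV P >-> 'S_n}) (A : {set 'S_n}) : Prop :=
  forall s : 'S_n, distribution P X [set s] = ((s \in A)%:R / #|A|%:R)%:E.

(* Convergence in probability to a constant; the X n may live on different    *)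
(* probability spaces.                                                        *)
Definition cvg_in_probability (R : realType) (d : nat -> measure_display)
    (T : forall n, measurableType (d n)) (P : forall n, probability (T n) R)
    (X : forall n, T n -> R) (c : R) : Prop :=
  forall eps : R, 0 < eps ->
    (fun n => P n [set w | eps < `|X n w - c|]) @ \oo --> 0%E.

(* Main.v *)
Require Import Defs.
From HB Require Import structures.
From mathcomp Require Import all_boot all_order all_algebra all_fingroup.
From mathcomp Require Import all_classical all_reals all_analysis.
From mathcomp Require Import zify ring lra.

Set Implicit Arguments.
Unset Strict Implicit.
Unset Printing Implicit Defensive.

Import Order.TTheory GRing.Theory Num.Theory.
Import numFieldNormedType.Exports.

(* Read a permutation from left to right, keeping a stack from which each new
   entry pops all the smaller ones; let d_j be the number of entries popped by
   the j-th one. A 231-avoiding permutation is determined by d, and the pattern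
   of a window is obtained by running the same procedure on the window of d,
   popping at most what the window itself has pushed. If the d_j are i.i.d.
   geometric of parameter 1/2, the window at a given position therefore has
   pattern p with probability 2^-(sum_j (d_j + [the stack is not emptied at j])),
   d being the sequence of p: the emptyings are the left-to-right maxima and the
   final stack consists of the right-to-left maxima, which gives the announced
   limit. By McDiarmid's inequality, the number of such windows deviates linearly
   from its mean with exponentially small probability. Since sum_j d_j <= n, each
   231-avoiding permutation of size n has probability at least 4^-n in the
   geometric model, and there are at least 4^n / (2 n (n + 1)) of them, so passing
   to the uniform 231-avoiding permutation costs only a polynomial factor. *)

(** * The stack procedure *)

Section Stack.
Implicit Types (f g : nat -> nat) (i j l : nat).

(** The stack just before entry [j] is read, from bottom to top, in closed form: the weak
    right-to-left maxima of the prefix. The popping rule is recovered in [stackS]. *)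
Definition stack f j : seq nat :=
  [seq i <- iota 0 j | all (fun l => f l <= f i) (index_iota i.+1 j)].

Definition pops f j : nat := count (fun i => f i < f j) (stack f j).

Lemma stackS f j : stack f j.+1 = rcons [seq i <- stack f j | f j <= f i] j.
Proof.
have iotaSr m k : iota m k.+1 = rcons (iota m k) (m + k).
  by rewrite -addn1 iotaD cats1.
rewrite /stack -filter_predI iotaSr filter_rcons /index_iota subnn /=.
congr rcons; apply: eq_in_filter => i; rewrite mem_iota => /= ij.
by rewrite subSn // iotaSr all_rcons subnKC.
Qed.

Lemma mem_stack f i j :
  (i \in stack f j) = (i < j) && all (fun l => f l <= f i) (index_iota i.+1 j).
Proof. by rewrite mem_filter mem_iota andbC. Qed.

Lemma pairwise_stack f j : pairwise (fun x y => f y <= f x) (stack f j).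
Proof.
elim: j => // j IH; rewrite stackS pairwise_rcons filter_all /=.
by apply: subseq_pairwise IH; apply: filter_subseq.
Qed.

(** Values weakly decrease towards the top, so the entries below [c] form a top segment and their
    number alone tells what remains. *)
Lemma filter_geq_take f c (S : seq nat) : pairwise (fun x y => f y <= f x) S ->
  [seq i <- S | c <= f i] = take (size S - count (fun i => f i < c) S) S.
Proof.
elim: S => [|x S IH] //= /andP[xS /IH ->].
have [cx|xc] /= := leqP c (f x); first by rewrite add0n subSn ?count_size.
have -> : count (fun i => f i < c) S = size S.
  apply/eqP; rewrite -all_count; apply: sub_all xS => y /= yx.
  exact: leq_ltn_trans yx xc.
by rewrite add1n !subnn take0.
Qed.

(** This recursion involves [f] only through the pop counts, which therefore determine all the
    stacks. *)
Lemma stackS_take f j :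
  stack f j.+1 = rcons (take (size (stack f j) - pops f j) (stack f j)) j.
Proof. by rewrite stackS filter_geq_take // pairwise_stack. Qed.

Lemma leq_pops f j : pops f j <= size (stack f j).
Proof. exact: count_size. Qed.

Lemma size_stackS f j :
  size (stack f j.+1) = (size (stack f j) - pops f j).+1.
Proof. by rewrite stackS_take size_rcons size_takel // leq_subr. Qed.

Lemma size_stack f j : size (stack f j) <= j.
Proof. by elim: j => // j; rewrite size_stackS ltnS; apply: leq_trans (leq_subr _ _). Qed.

(** Every entry read so far has either been popped or is still on the stack. *)
Lemma sum_pops f j : \sum_(i < j) pops f i + size (stack f j) = j.
Proof.
elim: j => [|j IH]; first by rewrite big_ord0.
by rewrite big_ord_recr /= size_stackS addnS -addnA subnKC ?leq_pops // IH.
Qed.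

Lemma eq_stack f g n : (forall j, j < n -> pops f j = pops g j) ->
  forall j, j <= n -> stack f j = stack g j.
Proof.
move=> fg; elim=> // j IH jn.
by rewrite !stackS_take fg // IH // ltnW.
Qed.

(** An entry leaves the stack only when a larger one is pushed. *)
Lemma stack_dominates f i j : i < j ->
  exists2 x, x \in stack f j & f i <= f x.
Proof.
elim: j => // j IH; rewrite ltnS leq_eqVlt => /predU1P[->|/IH[x xS ix]].
  by exists j; rewrite // stackS mem_rcons mem_head.
have [jx|xj] := leqP (f j) (f x).
  by exists x; rewrite // stackS mem_rcons inE mem_filter jx xS orbT.
exists j; first by rewrite stackS mem_rcons mem_head.
exact: leq_trans ix (ltnW xj).
Qed.

Lemma pops_full f j :
  (pops f j == size (stack f j)) = all (fun i => f i < f j) (iota 0 j).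
Proof.
rewrite -all_count; apply/allP/allP => [H i|H i].
  rewrite mem_iota => /= ij; have [x /H] := stack_dominates f ij.
  by move=> /= xj ix; exact: leq_ltn_trans ix xj.
by rewrite mem_stack => /andP[ij _]; apply: H; rewrite mem_iota.
Qed.

(* The elements of a window that are still on the stack form its top part. *)
Lemma stack_shift f a j : exists X, stack f (a + j) =
  X ++ [seq a + i | i <- stack (fun i => f (a + i)) j].
Proof.
rewrite /stack iotaD filter_cat; eexists; congr (_ ++ _).
have -> : iota (0 + a) j = [seq a + i | i <- iota 0 j].
  by rewrite add0n -iotaDl addn0.
rewrite filter_map; congr map.
apply: eq_filter => i /=; rewrite /index_iota -addnS iotaDl all_map subnDl.
by apply: eq_all.
Qed.

(** The window's entries lie on top of the older ones in [X] and are smaller or equal. If some entry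
    of [X] is popped, so are all those of the window; otherwise only window entries are popped. *)
Lemma pops_shift f a j : pops (fun i => f (a + i)) j =
  minn (pops f (a + j)) (size (stack (fun i => f (a + i)) j)).
Proof.
set g := fun i => f (a + i); rewrite {2}/pops.
have := pairwise_stack f (a + j); have [X ->] := stack_shift f a j.
rewrite count_cat count_map pairwise_cat => /andP[XS _].
rewrite -[count (preim _ _) _]/(pops g j).
have [/hasP[x xX xj]|/negbTE] := boolP (has (fun i => f i < f (a + j)) X).
  have -> : pops g j = size (stack g j); last by lia.
  apply/eqP; rewrite -all_count; apply/allP => y yS.
  move: XS => /allrelP/(_ x (a + y) xX (map_f _ yS)) yx.
  exact: leq_ltn_trans yx xj.
rewrite has_count => /negbT; have := leq_pops g j; lia.
Qed.

(** Here [h] is the number of entries that the window currently has on the stack: a letter pops at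
    most [h] of them, then pushes one. *)
Fixpoint trunc h (s : seq nat) : seq nat :=
  if s is d :: s' then minn d h :: trunc (h - minn d h).+1 s' else [::].

Lemma trunc_window f a k : trunc 0 [seq pops f j | j <- iota a k] =
  [seq pops (fun i => f (a + i)) j | j <- iota 0 k].
Proof.
set g := fun i => f (a + i).
(* The induction needs an arbitrary starting position [j] inside the window, with the window's stack
   size there as the cap. *)
suff H j : trunc (size (stack g j)) [seq pops f i | i <- iota (a + j) k] =
    [seq pops g i | i <- iota j k] by rewrite -(H 0) addn0.
elim: k j => //= k IH j.
by rewrite -pops_shift -size_stackS -IH addnS.
Qed.

Definition avoids231_fun n f := forall i j l,
  i < j -> j < l -> l < n -> f l < f i -> f i < f j -> False.

(** If an entry [l] strictly between [i] and [j] exceeded [i], then [f j < f i] would make [i], [l],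
    [j] an occurrence of 231. So once [j] is read, the earlier entries off the stack are exactly the
    smaller ones. *)
Lemma ltn_stack n f i j : {in gtn n &, injective f} -> avoids231_fun n f ->
  i < j -> j < n -> (f i < f j) = (i \notin stack f j.+1).
Proof.
move=> finj fav ij jn; rewrite mem_stack ltnS (ltnW ij) /= -has_predC.
apply/idP/hasP => [fij|[l]].
  by exists j; rewrite ?mem_index_iota ?ij ?ltnS //= -ltnNge.
rewrite mem_index_iota ltnS /= -ltnNge => /andP[il]; rewrite leq_eqVlt.
move=> /predU1P[->//|lj] fil; rewrite ltnNge; apply/negP.
rewrite leq_eqVlt => /predU1P[/finj|fji]; last exact: (fav i l j).
by rewrite !inE => /(_ jn (ltn_trans ij jn)); lia.
Qed.

(** By [ltn_stack] comparisons are stack memberships, and these depend on the pop counts only. *)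
Lemma eq_pops_order n f g :
  {in gtn n &, injective f} -> {in gtn n &, injective g} ->
  avoids231_fun n f -> avoids231_fun n g ->
  (forall j, j < n -> pops f j = pops g j) ->
  forall i j, i < n -> j < n -> (f i < f j) = (g i < g j).
Proof.
move=> fi gi fa ga fg.
have H i j : i < j -> j < n -> (f i < f j) = (g i < g j).
  by move=> ij jn; rewrite (ltn_stack fi) // (ltn_stack gi) // (eq_stack fg).
move=> i j iN jN; case: (ltngtP i j) => [/H->//|ji|->]; last by rewrite !ltnn.
have flip h : {in gtn n &, injective h} -> (h i < h j) = ~~ (h j < h i).
  move=> hi; rewrite -leqNgt [RHS]leq_eqVlt; case: eqP => //= /hi.
  by rewrite !inE => /(_ iN jN); lia.
by rewrite (flip f) // (flip g) // H.
Qed.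

Lemma pops_order n f g :
  (forall i j, i < n -> j < n -> (f i < f j) = (g i < g j)) ->
  forall j, j < n -> pops f j = pops g j.
Proof.
move=> fg j jn; rewrite /pops.
have -> : stack f j = stack g j.
  apply: eq_in_filter => i; rewrite mem_iota add0n => /= ij.
  apply: eq_in_all => l; rewrite mem_index_iota => /andP[_ lj].
  by rewrite leqNgt fg -?leqNgt //; exact: ltn_trans jn.
apply: eq_in_count => i; rewrite mem_stack => /andP[ij _].
by rewrite fg //; exact: ltn_trans jn.
Qed.

End Stack.

(** * Codes, windows and consecutive occurrences *)

Lemma card_ord_count n (P : pred nat) : #|[set i : 'I_n | P i]| = count P (iota 0 n).
Proof.
rewrite cardsE cardE /enum_mem size_filter -val_enum_ord count_map enumT.
exact: eq_count.
Qed.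

Lemma count_ltn m n : m <= n -> count (fun i => i < m) (iota 0 n) = m.
Proof.
move=> mn; rewrite -(subnKC mn) iotaD count_cat add0n.
have /eqP -> : count (fun i => i < m) (iota 0 m) == m.
  by rewrite -[X in _ == X](size_iota 0) -all_count; apply/allP => i; rewrite mem_iota.
rewrite -[RHS]addn0; congr (_ + _); apply/eqP; rewrite eqn0Ngt -has_count.
by apply/hasPn => i; rewrite mem_iota -leqNgt => /andP[].
Qed.

(** The value [s x] is recovered as the number of [y] with [s y < s x]. *)
Lemma perm_order_inj n (s t : 'S_n) :
  (forall x y, (s x < s y) = (t x < t y)) -> s = t.
Proof.
have E (u : 'S_n) x : #|[set y | u y < u x]| = u x.
  have -> : [set y | u y < u x] = u @^-1: [set z : 'I_n | z < u x].
    by apply/setP => y; rewrite !inE.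
  rewrite card_preimset; last exact: perm_inj.
  by rewrite (card_ord_count _ (fun z => z < u x)) count_ltn // ltnW.
move=> st; apply/permP => x; apply/val_inj; rewrite /= -[LHS]E -[RHS]E.
by congr #|pred_of_set _|; apply/setP => y; rewrite !inE.
Qed.

Lemma sorted_enum_ord n (A : {set 'I_n}) : sorted ltn (map val (enum A)).
Proof.
rewrite sorted_map /enum_mem; apply: sorted_filter.
  by move=> x y z; exact: ltn_trans.
by rewrite -enumT -sorted_map val_enum_ord iota_ltn_sorted.
Qed.

Lemma increasing_enum n k (A : {set 'I_n}) (e : 'I_k -> 'I_n) :
  (forall x y : 'I_k, x < y -> e x < e y) -> (forall i, (i \in A) = (i \in codom e)) ->
  codom e = enum A.
Proof.
move=> eh eA; apply/(inj_map val_inj)/(irr_sorted_eq ltn_trans ltnn).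
- rewrite sorted_map /codom /image_mem sorted_map.
  have := iota_ltn_sorted 0 k; rewrite -val_enum_ord sorted_map.
  by apply: sub_sorted => x y; exact: eh.
- exact: sorted_enum_ord.
- move=> i; apply/mapP/mapP => -[x xA ->]; exists x => //.
    by rewrite mem_enum eA.
  by rewrite -eA -mem_enum.
Qed.

Lemma increasing_unique n k (A : {set 'I_n}) (e e' : 'I_k -> 'I_n) :
  (forall x y : 'I_k, x < y -> e x < e y) -> (forall i, (i \in A) = (i \in codom e)) ->
  (forall x y : 'I_k, x < y -> e' x < e' y) -> (forall i, (i \in A) = (i \in codom e')) ->
  e =1 e'.
Proof.
move=> h1 h2 h3 h4; have := increasing_enum h3 h4.
rewrite -(increasing_enum h1 h2) => E x.
by move/eq_in_map: E => /(_ x) ->; rewrite ?mem_enum.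
Qed.

(** An increasing enumeration [e] of [A] replaces the dependent type ['S_#|A|], so that later
    arguments need no transport along [#|A| = k]. *)
Lemma same_patP n k (A : {set 'I_n}) (s : 'S_n) (p : 'S_k) :
  reflect (exists e : 'I_k -> 'I_n,
    [/\ forall x y : 'I_k, x < y -> e x < e y, forall i, (i \in A) = (i \in codom e)
      & forall x y, (p x < p y) = (s (e x) < s (e y))])
    (same_perm (pat A s) p).
Proof.
have homo_val (x y : 'I_#|A|) : x < y -> @enum_val _ A x < @enum_val _ A y.
  move=> xy; have i0 := enum_val x.
  rewrite !(enum_val_nth i0) -!(nth_map i0 0 val) -?cardE //.
  by rewrite (sorted_ltn_nth ltn_trans) // ?sorted_enum_ord // inE size_map -cardE.
have codom_val i : (i \in A) = (i \in codom (@enum_val _ A)).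
  apply/idP/codomP => [iA|[x ->]]; last exact: enum_valP.
  by exists (enum_rank_in iA i); rewrite enum_rankK_in.
apply: (iffP idP) => [|[e [eh eA ep]]].
  rewrite /same_perm => E; have ek : #|A| = k by move/eqP: E => /(congr1 tag).
  subst k; move: E; rewrite eq_Tagged /= => /eqP <-.
  by exists (@enum_val _ A); split=> // x y; rewrite pat_mono.
have ek : #|A| = k by rewrite cardE -(increasing_enum eh eA) size_codom card_ord.
subst k; rewrite /same_perm eq_Tagged /=; apply/eqP/perm_order_inj => x y.
by rewrite ep pat_mono !(increasing_unique eh eA homo_val codom_val).
Qed.

Definition pfun n (s : 'S_n) (i : nat) : nat :=
  oapp (fun x : 'I_n => nat_of_ord (s x)) 0 (insub i).

Lemma pfunE n (s : 'S_n) (i : 'I_n) : pfun s i = s i.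
Proof. by rewrite /pfun valK. Qed.

Lemma pfun_inj n (s : 'S_n) : {in gtn n &, injective (pfun s)}.
Proof.
move=> i j iN jN; rewrite -[i]/(val (Ordinal iN)) -[j]/(val (Ordinal jN)).
by rewrite !pfunE => /val_inj/perm_inj ->.
Qed.

Lemma avoids231P n (s : 'S_n) :
  reflect (avoids231_fun n (pfun s)) (avoids s perm231).
Proof.
apply: (iffP idP) => [sav i j l ij jl ln|sav].
  have jn := ltn_trans jl ln; have iN := ltn_trans ij jn.
  rewrite -[i]/(val (Ordinal iN)) -[j]/(val (Ordinal jn)) -[l]/(val (Ordinal ln)).
  rewrite !pfunE; set x := Ordinal iN; set y := Ordinal jn; set z := Ordinal ln.
  move=> zx xy; move/negP: sav; apply; apply/existsP; exists [set x; y; z].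
  apply/same_patP; exists (tnth [tuple x; y; z]); split.
  - move=> [[|[|[|a]]] Ha] [[|[|[|b]]] Hb] //= _.
    exact: ltn_trans jl.
  - move=> u; apply/idP/codomP => [|[[[|[|[|a]]] Ha] ->]];
      rewrite !inE ?(tnth_nth x) /= ?eqxx ?orbT //.
    by move=> /orP[/orP[]|] /eqP ->;
      [exists (@Ordinal 3 0 isT)|exists (@Ordinal 3 1 isT)|exists (@Ordinal 3 2 isT)].
  - by move=> [[|[|[|a]]] Ha] [[|[|[|b]]] Hb] //;
      rewrite !permE !(tnth_nth x) /=; lia.
apply/negP => /existsP[A /same_patP[e [eh _ ep]]].
pose o i (h : i < 3) : 'I_3 := Ordinal h.
apply: (sav (e (@o 0 isT)) (e (@o 1 isT)) (e (@o 2 isT))).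
- exact: eh.
- exact: eh.
- exact: ltn_ord.
- by rewrite !pfunE -ep !permE.
- by rewrite !pfunE -ep !permE.
Qed.

Definition stack_code n (s : 'S_n) : seq nat := [seq pops (pfun s) j | j <- iota 0 n].

Lemma size_stack_code n (s : 'S_n) : size (stack_code s) = n.
Proof. by rewrite size_map size_iota. Qed.

Lemma pfun_order_inj n (s t : 'S_n) :
  (forall i j, i < n -> j < n -> (pfun s i < pfun s j) = (pfun t i < pfun t j)) ->
  s = t.
Proof.
by move=> st; apply/perm_order_inj => x y; rewrite -!pfunE st.
Qed.

Lemma stack_code_inj n (s t : 'S_n) :
  s \in Av n perm231 -> t \in Av n perm231 -> stack_code s = stack_code t -> s = t.
Proof.
rewrite !inE => /avoids231P sav /avoids231P tav st; apply: pfun_order_inj.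
apply: eq_pops_order => //; [exact: pfun_inj|exact: pfun_inj|].
by move=> j jn; move/eq_in_map: st; apply; rewrite mem_iota.
Qed.

Definition window n k a : {set 'I_n} := [set i : 'I_n | a <= i < a + k].

Lemma same_pat_window n k a (s : 'S_n) (p : 'S_k) : a + k <= n ->
  reflect (forall x y, x < k -> y < k ->
             (pfun s (a + x) < pfun s (a + y)) = (pfun p x < pfun p y))
    (same_perm (pat (window n k a) s) p).
Proof.
move=> akn.
have lt (x : 'I_k) : a + x < n.
  by apply: leq_trans akn; rewrite ltn_add2l.
pose e x := Ordinal (lt x).
have eh (x y : 'I_k) : x < y -> e x < e y by rewrite /= ltn_add2l.
have eA i : (i \in window n k a) = (i \in codom e).
  rewrite inE; apply/andP/codomP => [[ai ik]|[x ->]].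
    have h : i - a < k by lia.
    by exists (Ordinal h); apply/val_inj; rewrite /= subnKC.
  by rewrite /= leq_addr ltn_add2l.
apply: (iffP (same_patP _ _ _)) => [[e' [eh' eA' ep']] x y xk yk|sp].
  rewrite -[x]/(val (Ordinal xk)) -[y]/(val (Ordinal yk)) !pfunE ep'.
  rewrite !(increasing_unique eh' eA' eh eA) -!pfunE //.
by exists e; split=> // x y; rewrite -!pfunE -sp.
Qed.

(** The window inherits the avoidance of 231, so its relative order amounts to its own pop counts,
    which [trunc_window] computes from the code of [s]. *)
Lemma same_pat_trunc n k a (s : 'S_n) (p : 'S_k) : a + k <= n ->
  s \in Av n perm231 -> p \in Av k perm231 ->
  same_perm (pat (window n k a) s) p =
  (trunc 0 (take k (drop a (stack_code s))) == stack_code p).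
Proof.
rewrite !inE => akn /avoids231P sav /avoids231P pav.
have -> : take k (drop a (stack_code s)) = [seq pops (pfun s) j | j <- iota a k].
  rewrite /stack_code -map_drop -map_take drop_iota add0n take_iota.
  by congr (map _ (iota _ _)); apply/minn_idPl; lia.
rewrite trunc_window; apply/(same_pat_window _ _ akn)/eqP => [sp|sp].
  by apply/eq_in_map => j; rewrite mem_iota /= => jk; apply: pops_order jk.
apply: eq_pops_order => //.
- move=> i j; rewrite !inE => ik jk /pfun_inj; rewrite !inE => h.
  by apply/(@addnI a)/h; lia.
- exact: pfun_inj.
- by move=> i j l ij jl lk; apply: sav; lia.
- by move=> j jk; move/eq_in_map: sp; apply; rewrite mem_iota.
Qed.

Lemma card_window n k a : a + k <= n -> #|window n k a| = k.
Proof.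
move=> akn; rewrite (card_ord_count _ (fun i => a <= i < a + k)).
rewrite (eq_count (a2 := predD (fun i => i < a + k) (fun i => i < a))); last first.
  by move=> i /=; rewrite -leqNgt.
have := count_predC (fun i => i < a) [seq i <- iota 0 n | i < a + k].
rewrite size_filter count_ltn // !count_filter.
rewrite (eq_count (a2 := fun i => i < a)); last by move=> i /=; lia.
rewrite count_ltn; last by lia.
by move=> /addnI h; rewrite -[RHS]h; apply: eq_count.
Qed.

Lemma window_interval n k a : int_interval (window n k a).
Proof.
apply/forall_inP => i; rewrite inE => /andP[ai ik]; apply/forall_inP => j.
rewrite inE => /andP[aj jk]; apply/forallP => l; apply/implyP; rewrite inE; lia.
Qed.

Lemma int_intervalP n k (A : {set 'I_n}) : 0 < k -> int_interval A -> #|A| = k ->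
  exists2 a, a + k <= n & A = window n k a.
Proof.
move=> k0 Aint Ak; have [i0 i0A] : exists i, i \in A by apply/card_gt0P; rewrite Ak.
have [a aA amin] := arg_minnP (fun i : 'I_n => val i) i0A.
have [b bA bmax] := arg_maxnP (fun i : 'I_n => val i) i0A.
have ab : a <= b by exact: amin.
have AE : A = window n (b.+1 - a) a.
  apply/setP => l; rewrite inE subnKC ?ltnS; last exact: ltnW.
  apply/idP/idP => [lA|abl].
    by rewrite (amin l lA : a <= l) (bmax l lA : l <= b).
  by move/forall_inP: Aint => /(_ a aA)/forall_inP/(_ b bA)/forallP/(_ l)/implyP; apply.
have bn := ltn_ord b.
have h : b.+1 - a = k by rewrite -Ak AE card_window //; lia.
by exists (nat_of_ord a); [lia|rewrite -h -AE].
Qed.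

Lemma cocc_count n k (s : 'S_n) (p : 'S_k) : 0 < k -> k <= n ->
  s \in Av n perm231 -> p \in Av k perm231 ->
  cocc p s = count (fun a => trunc 0 (take k (drop a (stack_code s))) == stack_code p)
                   (iota 0 (n - k).+1).
Proof.
move=> k0 kn sav pav; rewrite -(card_ord_count _ _) /cocc.
set B := [set i : 'I__ | _].
(* Since [0 < k], a window contains its starting index; testing both starting indices forces them to
   agree. *)
have win_inj : injective (fun a : 'I_(n - k).+1 => window n k a).
  move=> a b ab; apply/val_inj => /=; have ha := ltn_ord a; have hb := ltn_ord b.
  have an : a < n by lia.
  have bn : b < n by lia.
  have := congr1 (fun A : {set 'I_n} => Ordinal an \in A) ab.
  have := congr1 (fun A : {set 'I_n} => Ordinal bn \in A) ab.
  rewrite !inE /=; lia.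
rewrite -(card_imset B win_inj); apply: eq_card => A.
rewrite inE; apply/and3P/imsetP => [[Aint /eqP Ak sp]|[a aB ->]].
  have [a akn AE] := int_intervalP k0 Aint Ak.
  have ha : a < (n - k).+1 by lia.
  by exists (Ordinal ha); rewrite // inE -same_pat_trunc // -AE.
have akn : a + k <= n by have := ltn_ord a; lia.
split; [exact: window_interval|by rewrite card_window|].
by rewrite same_pat_trunc //; move: aB; rewrite inE.
Qed.

(** * Maxima read off the stack *)

Lemma LRMax_pops k (p : 'S_k) :
  LRMax p = \sum_(j < k) (pops (pfun p) j == size (stack (pfun p) j)).
Proof.
rewrite /LRMax -sum1_card big_mkcond /=; apply: eq_bigr => i _.
rewrite inE pops_full; congr nat_of_bool.
apply/forallP/allP => [H j|H j].
  rewrite mem_iota add0n => /= ji; have jk := ltn_trans ji (ltn_ord i).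
  by move/implyP: (H (Ordinal jk)) => /(_ ji); rewrite -!pfunE.
by apply/implyP => ji; rewrite -!pfunE; apply: H; rewrite mem_iota.
Qed.

(** The final stack holds the weak right-to-left maxima, which injectivity makes strict. *)
Lemma RLMax_stack k (p : 'S_k) : RLMax p = size (stack (pfun p) k).
Proof.
rewrite size_filter -card_ord_count; apply: eq_card => i; rewrite !inE.
apply/forallP/allP => [H j|H j].
  rewrite mem_index_iota => /andP[ij jk].
  by move/implyP: (H (Ordinal jk)) => /(_ ij)/ltnW; rewrite -!pfunE.
apply/implyP => ij; rewrite ltn_neqAle -!pfunE; apply/andP; split; last first.
  by apply: H; rewrite mem_index_iota ij /=.
apply/eqP => /pfun_inj; rewrite !inE => /(_ (ltn_ord _) (ltn_ord _)); lia.
Qed.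

(** * A lower bound for the number of 231-avoiding permutations *)

Section CatalanLowerBound.

Lemma pfun_lift n (s : 'S_n.+1) (v : 'I_n.+2) i : i < n.+1 ->
  pfun (lift_perm ord_max v s) i = bump v (pfun s i).
Proof.
move=> iN; set t := lift_perm _ _ _.
have -> : pfun t i = pfun t (lift ord_max (Ordinal iN)) by rewrite lift_max.
by rewrite pfunE lift_perm_lift -[i in RHS]/(nat_of_ord (Ordinal iN)) pfunE.
Qed.

(* A last entry v can be appended exactly when v is at least the previous last
   entry, which makes the permutations with given last entry a ballot count. *)
Lemma avoids231_lift n (s : 'S_n.+1) (v : 'I_n.+2) :
  s \in Av n.+1 perm231 -> s ord_max <= v ->
  lift_perm ord_max v s \in Av n.+2 perm231.
Proof.
rewrite !inE -pfunE => /avoids231P sav sv; apply/avoids231P => i j l ij jl ln.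
have ltn_bump2 x y : bump v x < bump v y -> x < y by rewrite /bump; lia.
have jn : j < n.+1 by lia.
have iN : i < n.+1 by lia.
rewrite !(pfun_lift s v jn, pfun_lift s v iN) => li /ltn_bump2 ij'.
move: ln; rewrite ltnS leq_eqVlt => /predU1P[ln|ln]; last first.
  by move: li; rewrite pfun_lift // => /ltn_bump2 li; apply: (sav i j l).
move: li; rewrite ln -[n.+1]/(val (@ord_max n.+1)) pfunE lift_perm_id => vi.
have {}vi : v <= pfun s i.
  move: vi; rewrite /bump; case: (leqP v (pfun s i)) => // h.
  by rewrite add0n ltnNge (ltnW h).
move: sv => /= sv; have ni : pfun s n < pfun s i.
  rewrite ltn_neqAle (leq_trans sv vi) andbT; apply/eqP => /pfun_inj.
  by rewrite !inE => /(_ (ltnSn _) iN); lia.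
have [jn'|jn'] := ltnP j n; first exact: (sav i j n).
have jE : j = n by lia.
by move: ij'; rewrite jE; lia.
Qed.

Definition Av_last n v : {set 'S_n.+1} :=
  [set s in Av n.+1 perm231 | s ord_max == v :> nat].

Definition Av_last_le n v : {set 'S_n.+1} :=
  [set s in Av n.+1 perm231 | s ord_max <= v].

Lemma card_Av_lastS n v : v <= n.+1 -> #|Av_last_le n v| <= #|Av_last n.+1 v|.
Proof.
move=> vn; pose w : 'I_n.+2 := Ordinal (vn : v < n.+2).
have inj : injective (lift_perm ord_max w : 'S_n.+1 -> 'S_n.+2).
  move=> s t /permP st; apply/permP => x.
  by apply: (@lift_inj _ w); rewrite -!(lift_perm_lift ord_max) st.
rewrite -(card_imset _ inj); apply/subset_leq_card/fintype.subsetP => u.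
case/imsetP => s; rewrite inE => /andP[sav sv] ->.
by rewrite inE avoids231_lift //= lift_perm_id.
Qed.

Lemma card_Av_last_leS n v :
  #|Av_last_le n v.+1| = #|Av_last_le n v| + #|Av_last n v.+1|.
Proof.
rewrite -cardsUI [X in _ = _ + X](_ : _ = 0).
  rewrite addn0; apply: eq_card => s; rewrite !inE -andb_orr.
  by rewrite leq_eqVlt orbC.
apply/eqP; rewrite cards_eq0; apply/eqP/setP => s; rewrite !inE.
by apply/negP => /andP[/andP[_ h] /andP[_ /eqP h']]; rewrite h' ltnn in h.
Qed.

Lemma card_Av_last_le0 n : #|Av_last_le n 0| = #|Av_last n 0|.
Proof. by apply: eq_card => s; rewrite !inE leqn0. Qed.

(* The ballot numbers C(m + v, v) - C(m + v, v - 1), for m = n + 1. *)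
Lemma card_Av_ballot n v : v <= n.+1 ->
  'C(n.+1 + v, v) <= #|Av_last_le n v| + (if v is u.+1 then 'C(n.+1 + v, u) else 0).
Proof.
elim: n v => [|n IH] v.
  have h u : 1%g \in Av_last_le 0 u.
    rewrite !inE perm1 andbT; apply/avoids231P => i j l; lia.
  have h1 u : 0 < #|Av_last_le 0 u| by apply/card_gt0P; exists 1%g.
  case: v => [|[|//]] _; first by rewrite bin0 addn0.
  by rewrite bin0 bin1; have := h1 1; lia.
elim: v => [|v IHv].
  move=> _; rewrite card_Av_last_le0 bin0 addn0.
  apply: leq_trans (card_Av_lastS _) => //.
  by have := IH 0 isT; rewrite bin0 addn0.
rewrite ltnS => vn.
have {IHv} := IHv (leq_trans vn (leqnSn _)).
move: vn; rewrite leq_eqVlt => /predU1P[->|vn].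
  (* The bound [n.+2] exceeds every possible last entry, so the count is carried over from [n.+1];
     the ballot number is unchanged too, by Pascal's rule and the symmetry of C(2n + 3, n + 1). *)
  move=> IHv; have : #|Av_last_le n.+1 n.+1| <= #|Av_last_le n.+1 n.+2|.
    by rewrite (card_Av_last_leS n.+1 n.+1) leq_addr.
  rewrite !addnS !addSn in IHv *.
  have := binS (n + n).+3 n.+1; have := binS (n + n).+3 n.
  have := @bin_sub (n + n).+3 n.+1.
  have -> : (n + n).+3 - n.+1 = n.+2 by lia.
  move=> /(_ ltac:(lia)); lia.
(* With B(m, v) the ballot number, Pascal's rule gives B(m + 1, v + 1) = B(m + 1, v) + B(m, v + 1),
   matched here by lower bounds on the two counts. *)
rewrite card_Av_last_leS => IHv.
have := IH v.+1 vn; have := card_Av_lastS vn.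
rewrite !addnS !addSn in IHv *.
have := binS (n + v).+2 v; case: v vn IHv => [|v] vn IHv.
  rewrite ?addn0 ?bin0 ?bin1 in IHv *; lia.
by have := binS (n + v.+1).+2 v; rewrite !addnS in IHv *; lia.
Qed.

(** As (m + 1) C(2m + 2, m + 1) = 2 (2m + 1) C(2m, m), the right side grows by a factor 4 + 2 / m at
    each step. *)
Lemma leq_central_bin m : 0 < m -> 4 ^ m <= 2 * m * 'C(m + m, m).
Proof.
elim: m => // -[|m] IH _; first by [].
have {IH} := IH isT; set k := m.+1; rewrite expnS.
have sym : 'C((k + k).+1, k.+1) = 'C((k + k).+1, k).
  by rewrite -bin_sub ?ltnS ?leq_addr // subSS addnK.
have := mul_bin_diag (k + k).+1 k; rewrite /= sym.
rewrite addnS addSn binS sym.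
move: ('C(k + k, k)) ('C((k + k).+1, k)) (4 ^ k) => x y z; nia.
Qed.

(** The full ballot count is C(2m, m) - C(2m, m - 1) = C(2m, m) / (m + 1), the Catalan number. *)
Lemma card_Av_lower_bound m : 0 < m ->
  4 ^ m <= 2 * m * m.+1 * #|Av m perm231|.
Proof.
case: m => // n _; have := leq_central_bin (ltn0Sn n).
have := card_Av_ballot (leqnn n.+1).
have := mul_bin_left (n.+1 + n.+1) n.
have -> : n.+1 + n.+1 - n = n.+2 by lia.
have : #|Av_last_le n n.+1| <= #|Av n.+1 perm231|.
  by apply/subset_leq_card/fintype.subsetP => s; rewrite inE => /andP[].
move: ('C(_, n)) ('C(_, n.+1)) (4 ^ _) #|_| #|_| => x y z a b.
nia.
Qed.

End CatalanLowerBound.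

(** * Words of independent truncated geometric letters *)

Section GeometricWords.
Local Open Scope ring_scope.
Variables (R : realType) (N : nat).
Implicit Types (f g : seq nat -> R) (s : seq nat).

(* The geometric law truncated at N, its tail being put on N so that the masses
   still sum to 1 and geom_tail is exact. *)
Definition geom (x : nat) : R := if (x < N)%N then 2 ^- x.+1 else 2 ^- N.

Lemma geom_ge0 x : 0 <= geom x.
Proof. by rewrite /geom; case: ifP => _; rewrite invr_ge0 exprn_ge0. Qed.

Lemma geom_tail h : (h <= N)%N -> \sum_(h <= x < N.+1) geom x = 2 ^- h.
Proof.
move=> hN; rewrite big_nat_recr //= {2}/geom ltnn.
rewrite (eq_big_nat _ _ (F2 := fun x => - 2 ^- x.+1 - - 2 ^- x)).
  by rewrite telescope_sumr // opprK addrAC addNr add0r.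
move=> x /andP[_ xN]; rewrite /geom xN exprS invfM.
have : (2 ^+ x : R) != 0 by rewrite expf_neq0.
by move=> h0; field.
Qed.

Lemma sum_geom : \sum_(x < N.+1) geom x = 1.
Proof. by rewrite -(big_mkord xpredT geom) geom_tail // expr0 invr1. Qed.

(** Expectation over [n] independent letters of law [geom], integrated from the first letter on; the
    recursion is the conditioning used in [expw_bounded_diff]. *)
Fixpoint expw n f : R :=
  if n is n'.+1 then \sum_(x < N.+1) geom x * expw n' (fun s => f (nat_of_ord x :: s))
  else f [::].

Lemma expwS n f : expw n.+1 f =
  \sum_(x < N.+1) geom x * expw n (fun s => f (nat_of_ord x :: s)).
Proof. by []. Qed.

Lemma ler_expw n f g : (forall s, size s = n -> f s <= g s) ->
  expw n f <= expw n g.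
Proof.
elim: n f g => [|n IH] f g fg /=; first exact: fg.
apply: ler_sum => x _; apply: ler_wpM2l; first exact: geom_ge0.
by apply: IH => s sn; apply: fg; rewrite /= sn.
Qed.

Lemma eq_expw n f g : (forall s, size s = n -> f s = g s) ->
  expw n f = expw n g.
Proof.
by move=> fg; apply/eqP; rewrite eq_le; apply/andP; split;
  apply: ler_expw => s sn; rewrite fg.
Qed.

Lemma expw_cst n c : expw n (fun=> c) = c.
Proof.
elim: n => //= n IH; under eq_bigr do rewrite IH.
by rewrite -mulr_suml sum_geom mul1r.
Qed.

Lemma expwZ n c f : expw n (fun s => c * f s) = c * expw n f.
Proof.
elim: n f => //= n IH f; rewrite mulr_sumr; apply: eq_bigr => x _.
by rewrite IH mulrCA.
Qed.

Lemma expwD n f g : expw n (fun s => f s + g s) = expw n f + expw n g.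
Proof.
elim: n f g => //= n IH f g; rewrite -big_split /=; apply: eq_bigr => x _.
by rewrite IH mulrDr.
Qed.

Lemma expw_sum n m (F : nat -> seq nat -> R) :
  expw n (fun s => \sum_(a < m) F a s) = \sum_(a < m) expw n (F a).
Proof.
elim: m => [|m IH].
  rewrite big_ord0 -[RHS](expw_cst n); apply: eq_expw => s _.
  by rewrite big_ord0.
rewrite big_ord_recr /= -IH -expwD; apply: eq_expw => s _.
by rewrite big_ord_recr.
Qed.

Lemma expw_cat a b f :
  expw (a + b) f = expw a (fun s => expw b (fun t => f (s ++ t))).
Proof. by elim: a f => //= a IH f; apply: eq_bigr => x _; rewrite IH. Qed.

(** * Expectations as weighted sums over words *)

Fixpoint words n : seq (seq nat) :=
  if n is n'.+1 then [seq x :: s | x <- iota 0 N.+1, s <- words n'] else [:: [::]].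

Lemma wordsS n : words n.+1 = [seq x :: s | x <- iota 0 N.+1, s <- words n].
Proof. by []. Qed.

Lemma words_uniq n : uniq (words n).
Proof.
elim: n => [|n IH] //; rewrite wordsS; apply: allpairs_uniq => //.
  exact: iota_uniq.
by move=> [x s] [y t] _ _ [-> ->].
Qed.

Lemma mem_words n s : size s = n -> all (fun x => x <= N)%N s -> s \in words n.
Proof.
elim: n s => [|n IH] [|x s] // [sn] /andP[xN sN]; rewrite wordsS.
by apply: allpairs_f; [rewrite mem_iota|exact: IH].
Qed.

Lemma expw_words n f :
  expw n f = \sum_(s <- words n) (\prod_(x <- s) geom x) * f s.
Proof.
elim: n f => [|n IH] f; first by rewrite /= big_seq1 big_nil mul1r.
rewrite expwS wordsS big_allpairs_dep -[iota 0 N.+1]/(index_iota 0 N.+1) big_mkord.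
apply: eq_bigr => x _; rewrite IH mulr_sumr; apply: eq_bigr => s _.
by rewrite big_cons mulrA.
Qed.

Lemma sum_weight_le_expw n (A : seq (seq nat)) f :
  uniq A -> {in A, forall s, size s = n /\ all (fun x => x <= N)%N s} ->
  (forall s, 0 <= f s) ->
  \sum_(s <- A) (\prod_(x <- s) geom x) * f s <= expw n f.
Proof.
move=> Auniq Asize f0.
have AE : perm_eq [seq s <- words n | s \in A] A.
  apply: uniq_perm => //; first exact: filter_uniq (words_uniq n).
  move=> s; rewrite mem_filter; case sA: (s \in A) => //=.
  by have [sn sN] := Asize _ sA; rewrite mem_words.
rewrite expw_words -(perm_big _ AE) /= big_filter [leRHS](bigID (mem A)) /=.
rewrite lerDl sumr_ge0 // => s _.
by rewrite mulr_ge0 // prodr_ge0 // => x _; exact: geom_ge0.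
Qed.

(** * Exponential moments and deviations *)

Lemma expR_le_quadratic (t : R) : t <= 2^-1 -> expR t <= 1 + t + 2 * t ^+ 2.
Proof.
move=> t2; have := expR_ge1Dx (- t); rewrite expRN => h.
have e0 := expR_gt0 t.
have h1 : expR t * (1 - t) <= 1.
  by rewrite mulrC -ler_pdivlMr // mul1r.
(* The product equals 1 + t^2 (1 - 2t). *)
have h2 : 1 <= (1 + t + 2 * t ^+ 2) * (1 - t).
  have : 0 <= t ^+ 2 * (1 - 2 * t) by rewrite mulr_ge0 ?sqr_ge0 //; lra.
  lra.
by rewrite -(@ler_pM2r _ (1 - t)); [exact: le_trans h2|lra].
Qed.

(** Words of all lengths are allowed, so the property passes to [f] with its first letter fixed. *)
Definition bounded_diff (c : R) f :=
  forall u x y v, `|f (u ++ x :: v) - f (u ++ y :: v)| <= c.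

(* McDiarmid's argument: conditioning on the letters one at a time, every
   conditional increment is centered and bounded by c. *)
Lemma expw_bounded_diff n f (c theta : R) : bounded_diff c f ->
  `|theta| * c <= 2^-1 ->
  expw n (fun s => expR (theta * (f s - expw n f))) <=
  expR (n%:R * (2 * (theta * c) ^+ 2)).
Proof.
move=> + tc; elim: n f => [|n IH] f fc.
  by rewrite /= subrr mulr0 mul0r.
set m := expw n.+1 f; pose h (x : 'I_N.+1) := expw n (fun s => f (nat_of_ord x :: s)).
have mE : m = \sum_(x < N.+1) geom x * h x by [].
have h_diff x y : `|h x - h y| <= c.
  have e z : - h z = expw n (fun s => -1 * f (nat_of_ord z :: s)).
    by rewrite expwZ mulN1r.
  rewrite ler_norml; apply/andP; split.
    rewrite -[- c](expw_cst n) e -expwD; apply: ler_expw => s _.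
    by have := fc [::] x y s; rewrite mulN1r ler_norml => /andP[].
  rewrite -[leRHS](expw_cst n) e -expwD; apply: ler_expw => s _.
  by have := fc [::] x y s; rewrite mulN1r ler_norml => /andP[].
have hm x : `|h x - m| <= c.
  have -> : h x - m = \sum_(y < N.+1) geom y * (h x - h y).
    rewrite mE -[h x in LHS]mul1r -sum_geom mulr_suml -sumrB.
    by apply: eq_bigr => y _; rewrite mulrBr.
  apply: le_trans (ler_norm_sum _ _ _) _.
  rewrite -[leRHS]mul1r -sum_geom mulr_suml; apply: ler_sum => y _.
  by rewrite normrM ger0_norm ?geom_ge0 // ler_wpM2l ?geom_ge0.
have step x : expw n (fun s => expR (theta * (f (nat_of_ord x :: s) - m))) <=
    expR (theta * (h x - m)) * expR (n%:R * (2 * (theta * c) ^+ 2)).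
  have -> : expw n (fun s => expR (theta * (f (nat_of_ord x :: s) - m))) =
      expR (theta * (h x - m)) *
      expw n (fun s => expR (theta * (f (nat_of_ord x :: s) - h x))).
    rewrite -expwZ; apply: eq_expw => s _.
    by rewrite -expRD; congr expR; ring.
  rewrite ler_pM2l ?expR_gt0 //; apply: (IH (fun s => f (nat_of_ord x :: s))).
  by move=> u y z v; exact: (fc (nat_of_ord x :: u)).
apply: (@le_trans _ _ (\sum_(x < N.+1) geom x *
    ((1 + theta * (h x - m) + 2 * (theta * c) ^+ 2) *
     expR (n%:R * (2 * (theta * c) ^+ 2))))).
  apply: ler_sum => x _; rewrite ler_wpM2l ?geom_ge0 //.
  apply: le_trans (step x) _; rewrite ler_pM2r ?expR_gt0 //.
  have tx : `|theta * (h x - m)| <= `|theta| * c.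
    by rewrite normrM ler_wpM2l.
  apply: le_trans (expR_le_quadratic _) _.
    exact: le_trans (ler_norm _) (le_trans tx tc).
  rewrite lerD2l ler_pM2l // -real_normK ?num_real // -[leRHS]real_normK ?num_real //.
  rewrite lerXn2r ?nnegrE //; apply: le_trans tx _.
  by rewrite normrM ler_wpM2l // ler_norm.
under eq_bigr do rewrite mulrA.
have -> : n.+1%:R * (2 * (theta * c) ^+ 2) =
    2 * (theta * c) ^+ 2 + n%:R * (2 * (theta * c) ^+ 2) by rewrite -natr1; ring.
rewrite -mulr_suml expRD ler_pM2r ?expR_gt0 //.
(* The linear term averages to 0 because [m] is the mean of [h]; what is left, 1 + 2 (theta c)^2, is
   at most its exponential. *)
apply: le_trans (expR_ge1Dx _).
rewrite le_eqVlt; apply/orP; left; apply/eqP.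
transitivity (\sum_(x < N.+1) (geom x * (1 + 2 * (theta * c) ^+ 2)
    + theta * (geom x * h x - geom x * m))).
  by apply: eq_bigr => x _; ring.
rewrite big_split /= -mulr_suml sum_geom -mulr_sumr sumrB -mE.
by rewrite -mulr_suml sum_geom !mul1r subrr mulr0 addr0.
Qed.

(** Chernoff's bound: the indicator is at most the sum of the exponentials for [theta] and
    [- theta], one for each sign of the deviation. *)
Lemma expw_deviation n f (c theta t : R) : bounded_diff c f ->
  0 < theta -> theta * c <= 2^-1 ->
  expw n (fun s => (t < `|f s - expw n f|)%R%:R) <=
  2 * expR (n%:R * (2 * (theta * c) ^+ 2) - theta * t).
Proof.
move=> fc t0 tc; set m := expw n f.
apply: (@le_trans _ _ (expw n (fun s =>
    expR (- (theta * t)) * expR (theta * (f s - m)) +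
    expR (- (theta * t)) * expR (- theta * (f s - m))))).
  apply: ler_expw => s _; rewrite -!expRD.
  have [tX|_] := ltP; last by rewrite addr_ge0 ?expR_ge0.
  have e1 (x : R) : 0 <= x -> 1 <= expR x.
    by move=> x0; apply: le_trans (expR_ge1Dx x); rewrite lerDl.
  have [X0|X0] := leP 0 (f s - m).
    rewrite ger0_norm // in tX.
    apply: (@le_trans _ _ (expR (- (theta * t) + theta * (f s - m)))).
      apply: e1; rewrite addrC -mulrBr mulr_ge0 ?ltW // subr_gt0 //.
    by rewrite lerDl expR_ge0.
  rewrite ltr0_norm // in tX.
  apply: (@le_trans _ _ (expR (- (theta * t) + - theta * (f s - m)))).
    by apply: e1; rewrite mulNr -mulrN addrC -mulrBr mulr_ge0 ?ltW // subr_gt0.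
  by rewrite lerDr expR_ge0.
rewrite expwD !expwZ expRD; set X := expR (_ * _); set Y := expR (- _).
have -> : 2 * (X * Y) = Y * X + Y * X by ring.
rewrite lerD // ler_pM2l ?expR_gt0 //.
  by apply: expw_bounded_diff; rewrite ?gtr0_norm.
rewrite /X -sqrrN -mulNr.
by apply: expw_bounded_diff; rewrite ?normrN ?gtr0_norm.
Qed.

(** * The law of one window and the number of matching windows *)

Lemma geom_minn h c : (c <= h)%N -> (h <= N)%N ->
  \sum_(x < N.+1) geom x * (minn x h == c)%:R = 2 ^- (c + (c < h)).
Proof.
move=> ch hN; rewrite -(big_mkord xpredT (fun x => geom x * (minn x h == c)%:R)).
(* For [c < h] only the letter [c] contributes; for [c = h] the whole tail from [h] on does, whose
   mass has one factor 1/2 less. *)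
have [c_lt|hc] := ltnP c h.
  have cN := leq_trans c_lt hN.
  have cN1 : (c \in index_iota 0 N.+1) by rewrite mem_index_iota ltnS (ltnW cN).
  rewrite (bigD1_seq c) ?iota_uniq //=.
  rewrite (minn_idPl ch) eqxx mulr1 big1_seq ?addr0 ?addn1 ?/geom ?cN //.
  move=> x /andP[xc _]; case: eqP => [xh|]; last by rewrite mulr0.
  by exfalso; move/eqP: xc; lia.
have -> : c = h by apply/eqP; rewrite eqn_leq ch hc.
rewrite addn0 -[RHS]geom_tail // (big_cat_nat (n := h)) //=; last exact: leqW.
rewrite big_nat_cond big1 ?add0r => [|x].
  apply: eq_big_nat => x /andP[hx _].
  by rewrite (minn_idPr hx) eqxx mulr1.
rewrite andbT => /andP[_ xh]; case: eqP => [|]; last by rewrite mulr0.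
by move=> E; exfalso; lia.
Qed.

(** Once a letter matches, the next stack size is that of [f], so the probabilities of [geom_minn]
    multiply. *)
Lemma expw_trunc (f : nat -> nat) j k : (j + k <= N)%N ->
  expw k (fun s => (trunc (size (stack f j)) s == [seq pops f i | i <- iota j k])%:R)
  = \prod_(i <- iota j k) 2 ^- (pops f i + (pops f i < size (stack f i))).
Proof.
elim: k j => [|k IH] j jk /=; first by rewrite big_nil.
have hN : (size (stack f j) <= N)%N.
  by apply: leq_trans (size_stack _ _) _; lia.
rewrite big_cons -(geom_minn (leq_pops f j) hN) mulr_suml.
apply: eq_bigr => x _; rewrite -mulrA; congr (_ * _).
rewrite -IH; last by lia.
rewrite -expwZ; apply: eq_expw => s _; rewrite eqseq_cons.
case: eqP => [->|_]; last by rewrite mul0r.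
by rewrite mul1r size_stackS.
Qed.

(** The pops sum to k - RLMax and the steps that do not empty the stack number k - LRMax, so the
    exponent is 2k - LRMax - RLMax. *)
Lemma expw_trunc_stack_code k (p : 'S_k) : (k <= N)%N ->
  expw k (fun s => (trunc 0 s == stack_code p)%:R) =
  2 ^+ (LRMax p + RLMax p) / 2 ^+ (2 * k).
Proof.
move=> kN; rewrite (@expw_trunc (pfun p) 0) //.
have -> : iota 0 k = index_iota 0 k by rewrite /index_iota subn0.
rewrite big_mkord prodfV prodrXr.
have h0 m : (2 ^+ m : R) != 0 by rewrite expf_neq0.
apply: (mulfI (h0 (2 * k)%N)); rewrite mulrCA divff // mulr1.
apply: (mulIf (h0 (\sum_(i < k) (pops (pfun p) i +
  (pops (pfun p) i < size (stack (pfun p) i))))%N)).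
rewrite mulfVK // -exprD; congr (_ ^+ _).
rewrite LRMax_pops RLMax_stack big_split /=.
have := sum_pops (pfun p) k.
have : (\sum_(i < k) (pops (pfun p) i == size (stack (pfun p) i)) +
        \sum_(i < k) (pops (pfun p) i < size (stack (pfun p) i)) = k)%N.
  rewrite -big_split /= -[RHS]card_ord -sum1_card; apply: eq_bigr => i _.
  by have := leq_pops (pfun p) i; case: ltngtP.
have sum4 a b c d : (a + b = k -> c + d = k -> 2 * k = a + d + (c + b))%N by lia.
exact: sum4.
Qed.

Definition window_count k (c : seq nat) m s : R :=
  \sum_(a < m) (trunc 0 (take k (drop a s)) == c)%:R.

(** Only windows containing the changed position [size u] see the change, and at most [k] of them
    do. *)
Lemma bounded_diff_window_count k c m : bounded_diff k%:R (window_count k c m).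
Proof.
move=> u x y v; rewrite /window_count -sumrB.
apply: le_trans (ler_norm_sum _ _ _) _.
apply: (@le_trans _ _ (\sum_(a < m) (a <= size u < a + k)%N%:R : R)).
  apply: ler_sum => a _.
  have le1 (b b' : bool) : `|b%:R - b'%:R : R| <= 1.
    by case: b; case: b'; rewrite ?subrr ?subr0 ?sub0r ?normrN ?normr0 ?normr1.
  rewrite !drop_cat; have [au|ua] := ltnP a (size u).
    have [ku|uk] := leqP (a + k) (size u).
      by rewrite !takel_cat ?subrr ?normr0 ?ler0n // size_drop; lia.
    by rewrite (ltnW au) le1.
  rewrite leq_eqVlt; have [->|] := eqVneq (a : nat) (size u).
    by case: k => [|k]; rewrite ?take0 ?subrr ?normr0 ?ler0n // addnS ltnS leq_addr.
  move=> /eqP aN; have : (size u < a)%N by lia.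
  rewrite -subn_gt0; case: (a - size u)%N => // d _ /=.
  by rewrite subrr normr0 ler0n.
rewrite -natr_sum ler_nat -(big_mkord xpredT (fun a => (a <= size u < a + k)%N : nat)).
have -> : (\sum_(0 <= a < m) (a <= size u < a + k) =
    count (fun a => a <= size u < a + k) (iota 0 m))%N.
  rewrite -sum1_count [RHS]big_mkcond /index_iota subn0.
  by apply: eq_bigr => a _; case: ifP.
rewrite -size_filter -[leqRHS](size_iota ((size u).+1 - k) k).
apply: uniq_leq_size; first exact: filter_uniq (iota_uniq _ _).
by move=> a; rewrite mem_filter !mem_iota; lia.
Qed.

Lemma expw_window n k a f : (a + k <= n)%N ->
  expw n (fun s => f (take k (drop a s))) = expw k f.
Proof.
move=> akn; have -> : n = (a + (k + (n - a - k)))%N by lia.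
rewrite expw_cat -[RHS](expw_cst a); apply: eq_expw => s sa.
rewrite expw_cat; apply: eq_expw => t tk.
rewrite -[RHS](expw_cst (n - a - k)); apply: eq_expw => u _.
by rewrite drop_size_cat // take_size_cat.
Qed.

Lemma expw_window_count n k (p : 'S_k) : (k <= n)%N -> (k <= N)%N ->
  expw n (window_count k (stack_code p) (n - k).+1) =
  (n - k).+1%:R * (2 ^+ (LRMax p + RLMax p) / 2 ^+ (2 * k)).
Proof.
move=> kn kN.
rewrite (expw_sum n _ (fun a s => (trunc 0 (take k (drop a s)) == stack_code p)%:R)).
rewrite (eq_bigr (fun=> 2 ^+ (LRMax p + RLMax p) / 2 ^+ (2 * k))).
  by rewrite sumr_const card_ord mulr_natl.
move=> a _; rewrite (@expw_window n k a (fun s => (trunc 0 s == stack_code p)%:R)).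
  exact: expw_trunc_stack_code.
by have := ltn_ord a; lia.
Qed.

End GeometricWords.
(** * Concentration for uniform 231-avoiding permutations *)

Local Open Scope classical_set_scope.
Local Open Scope ring_scope.

Lemma uniform_on_preimage (R : realType) (d : measure_display)
    (T : measurableType d) (P : probability T R) n
    (X : {RV P >-> 'S_n}) (A : {set 'S_n}) (B : pred 'S_n) :
  uniform_on X A ->
  P [set w | B (X w)] = (#|[set s in A | B s]%SET|%:R / #|A|%:R)%:E.
Proof.
move=> XA; have -> : [set w | B (X w)] =
    \bigcup_(s in [set` enum B]) (X @^-1` [set s]).
  apply/seteqP; split=> [w /= Bw|w [s /=]].
    by exists (X w) => //=; rewrite mem_enum.
  by rewrite mem_enum => Bs ->.
rewrite measure_fin_bigcup //.
- rewrite -fsbig_seq ?enum_uniq // (eq_bigr (fun s => ((s \in A)%:R / #|A|%:R)%:E)).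
    rewrite sumEFin -mulr_suml big_enum_cond /= -natr_sum; congr (_%:R / _)%:E.
    rewrite -sum1_card big_mkcond [RHS]big_mkcond /=; apply: eq_bigr => s _.
    by rewrite inE unfold_in; case: (s \in A); case: (B s).
  by move=> s _; rewrite -XA.
- by move=> s t _ _ [w [/= -> ->]].
- by move=> s _; exact: measurable_funPTI.
Qed.

Section Concentration.
Variable R : realType.

Lemma window_countE k (c : seq nat) m s : window_count R k c m s =
  (count (fun a => trunc 0 (take k (drop a s)) == c) (iota 0 m))%:R.
Proof.
rewrite /window_count -natr_sum; congr (_%:R).
rewrite -(big_mkord xpredT (fun a => (trunc 0 (take k (drop a s)) == c) : nat)).
rewrite -sum1_count [RHS]big_mkcond /index_iota subn0.
by apply: eq_bigr => a _; case: ifP.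
Qed.

(** A letter x has mass at least 2^-(x + 1), the truncation only increasing it. *)
Lemma prod_geom_lower_bound N (s : seq nat) :
  2 ^- (sumn s + size s) <= \prod_(x <- s) geom R N x.
Proof.
elim: s => [|x s IH]; first by rewrite big_nil expr0 invr1.
rewrite big_cons /=.
have -> : (x + sumn s + (size s).+1 = x.+1 + (sumn s + size s))%N by lia.
rewrite exprD invfM ler_pM ?invr_ge0 ?exprn_ge0 //.
rewrite /geom; case: ltnP => // Nx.
rewrite lef_pV2 ?posrE ?exprn_gt0 // ler_eXn2l ?ltr1n //; lia.
Qed.

Lemma sumn_stack_code n (s : 'S_n) : (sumn (stack_code s) <= n)%N.
Proof.
rewrite sumnE big_map (_ : iota 0 n = index_iota 0 n) ?big_mkord; last first.
  by rewrite /index_iota subn0.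
by rewrite -[leqRHS](sum_pops (pfun s) n) leq_addr.
Qed.

Lemma stack_code_le n (s : 'S_n) : all (fun x => x <= n)%N (stack_code s).
Proof.
apply/allP => x /mapP[j]; rewrite mem_iota => /= jn ->.
by apply: leq_trans (leq_pops _ _) (leq_trans (size_stack _ _) (ltnW jn)).
Qed.

(** Change of measure: codes are distinct, and each has [n] letters of sum at most [n], hence weight
    at least 4^-n. *)
Lemma card_stack_code_le_expw n (A : {set 'S_n}) (B : pred (seq nat)) :
  A \subset Av n perm231 -> (forall s, s \in A -> B (stack_code s)) ->
  #|A|%:R <= 4 ^+ n * expw n n (fun s => (B s)%:R : R).
Proof.
move=> Aav AB; rewrite -ler_pdivrMl ?exprn_gt0 //.
have codes_uniq : uniq [seq stack_code s | s <- enum A].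
  rewrite map_inj_in_uniq ?enum_uniq // => s t; rewrite !mem_enum => sA tA.
  by apply: stack_code_inj; exact: (fintype.subsetP Aav).
apply: (le_trans _ (sum_weight_le_expw codes_uniq _ _)) => //; last first.
  move=> x /mapP[s _ ->]; split; [exact: size_stack_code|exact: stack_code_le].
rewrite big_map big_enum /= -sum1_card natr_sum mulr_sumr; apply: ler_sum => s sA.
rewrite AB // !mulr1; apply: le_trans (prod_geom_lower_bound n (stack_code s)).
rewrite lef_pV2 ?posrE ?exprn_gt0 // (_ : 4 = 2 ^+ 2) -?exprM; last by rewrite -natrX.
rewrite ler_eXn2l ?ltr1n // size_stack_code.
by have := sumn_stack_code s; lia.
Qed.

Lemma limit_freq_itv k (p : 'S_k) :
  0 <= (2 ^+ (LRMax p + RLMax p) / 2 ^+ (2 * k) : R) <= 1.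
Proof.
rewrite -(expw_trunc_stack_code R p (leqnn k)); apply/andP; split.
  by rewrite -[leLHS](expw_cst k k); apply: ler_expw => s _.
by rewrite -[leRHS](expw_cst k k); apply: ler_expw => s _; rewrite lern1 leq_b1.
Qed.

Definition deviating n k (p : 'S_k) (eps : R) : {set 'S_n} :=
  [set s in Av n perm231 |
    eps < `|cocc_freq R p s - 2 ^+ (LRMax p + RLMax p) / 2 ^+ (2 * k)|]%SET.

Lemma card_deviating n k (p : 'S_k) (eps theta : R) :
  (0 < k)%N -> (k <= n)%N -> p \in Av k perm231 ->
  0 < theta -> theta * k%:R <= 2^-1 ->
  #|deviating n p eps|%:R <= 4 ^+ n *
    (2 * expR (n%:R * (2 * (theta * k%:R) ^+ 2) - theta * (n%:R * eps - k%:R))).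
Proof.
move=> k0 kn pav t0 tk; set q : R := 2 ^+ (LRMax p + RLMax p) / 2 ^+ (2 * k).
pose F := window_count R k (stack_code p) (n - k).+1.
(* There are n - k + 1 windows rather than n, so the mean differs from [n q] by (k - 1) q, which is
   less than k. *)
pose t := n%:R * eps - k%:R.
have n0 : 0 < n%:R :> R by rewrite ltr0n (leq_trans k0).
have [q0 q1] := andP (limit_freq_itv p); rewrite -/q in q0 q1.
apply: (@le_trans _ _ (4 ^+ n *
    expw n n (fun s => (t < `|F s - expw n n F|)%R%:R))); last first.
  rewrite ler_pM2l ?exprn_gt0 //.
  by apply: expw_deviation => //; exact: bounded_diff_window_count.
apply: card_stack_code_le_expw.
  by apply/fintype.subsetP => s; rewrite inE => /andP[].
move=> s; rewrite inE => /andP[sav]; rewrite /cocc_freq cocc_count // -window_countE.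
rewrite -/F -/q (expw_window_count R p kn kn) -/q => dev.
have {}dev : n%:R * eps < `|F (stack_code s) - n%:R * q|.
  have -> : F (stack_code s) - n%:R * q = n%:R * (F (stack_code s) / n%:R - q).
    by field; rewrite gt_eqF.
  by rewrite normrM gtr0_norm // ltr_pM2l.
have e : (n - k).+1%:R = n%:R + 1 - k%:R :> R by rewrite -natr1 natrB //; ring.
have k1 : 1 <= k%:R :> R by rewrite ler1n.
have -> : F (stack_code s) - (n - k).+1%:R * q =
    F (stack_code s) - n%:R * q + (k%:R - 1) * q by rewrite e; ring.
have h : (k%:R - 1) * q <= k%:R - 1 by rewrite ler_piMr // subr_ge0.
have h0 : 0 <= (k%:R - 1) * q by rewrite mulr_ge0 // subr_ge0.
have := lerB_normD (F (stack_code s) - n%:R * q) ((k%:R - 1) * q).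
rewrite (ger0_norm h0) /t; lra.
Qed.

(** The factor [expR x] is the cube of [expR (x / 3)], itself at least [x / 3]. A cube beats the
    quadratic loss of [card_Av_lower_bound] with a factor 1 / n to spare. *)
Lemma inv_expR_le_cube (x : R) : 0 < x -> expR (- x) <= 27 / x ^+ 3.
Proof.
move=> x0; rewrite expRN -[leLHS]div1r ler_pdivrMr ?expR_gt0 //.
rewrite mulrAC ler_pdivlMr ?exprn_gt0 // mul1r.
have -> : expR x = expR (x / 3) ^+ 3 by rewrite -expRM_natl; congr expR; field.
have h : x / 3 <= expR (x / 3).
  by apply: le_trans (expR_ge1Dx _); rewrite lerDr.
have -> : x ^+ 3 = 27 * (x / 3) ^+ 3 by field.
by rewrite ler_pM2l // lerXn2r ?nnegrE ?expR_ge0 // divr_ge0 // ltW.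
Qed.

Lemma deviation_bound k (p : 'S_k) (eps : R) : (0 < k)%N ->
  p \in Av k perm231 -> 0 < eps ->
  exists K : R, forall n, (k <= n)%N ->
    #|deviating n p eps|%:R / #|Av n perm231|%:R <= K * n.+1%:R^-1.
Proof.
move=> k0 pav eps0; have k1 : 1 <= k%:R :> R by rewrite ler1n.
(* The cap 1 ensures theta k <= 1/2; the cap [eps] keeps the quadratic term below the linear
   gain. *)
pose x : R := Num.min 1 eps.
have x0 : 0 < x by rewrite lt_min ltr01.
have [x1 xe] : x <= 1 /\ x <= eps by rewrite !ge_min !lexx orbT.
(* With this theta, the quadratic term of the exponent is n x^2 / (8 k^2),
   at most half of the linear gain n theta eps. *)
pose theta : R := x / (4 * k%:R ^+ 2).
have kk : 0 < 4 * k%:R ^+ 2 :> R by rewrite mulr_gt0 ?exprn_gt0 // ltr0n.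
have t0 : 0 < theta by rewrite divr_gt0.
have tkE : theta * k%:R = x / (4 * k%:R) by rewrite /theta; field; rewrite pnatr_eq0; lia.
have tk : theta * k%:R <= 2^-1.
  by rewrite tkE ler_pdivrMr; lra.
(* The surviving rate: the exponent will be at most 1 - n delta, the 1 absorbing [theta * k]. *)
pose delta := theta * eps / 2.
have d0 : 0 < delta by rewrite /delta divr_gt0 // mulr_gt0.
(* In 16, a factor 4 comes from the 2 of the Catalan bound and the 2 of the two-sided deviation, the
   other 4 from (n + 1) / n^2 <= 4 / (n + 1). *)
exists (16 * expR 1 * (27 / delta ^+ 3)) => n kn.
have n0 : (0 < n)%N := leq_trans k0 kn.
have nR : 1 <= n%:R :> R by rewrite ler1n.
have cat := card_Av_lower_bound n0.
have catR : 4 ^+ n <= 2 * n%:R * n.+1%:R * #|Av n perm231|%:R :> R.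
  by move: cat; rewrite -(ler_nat R) natrX !natrM.
have Av0 : 0 < #|Av n perm231|%:R :> R.
  rewrite ltr0n lt0n; apply: contraL cat => /eqP ->.
  by rewrite muln0 leqn0 expn_eq0.
rewrite ler_pdivrMr //.
apply: le_trans (card_deviating eps k0 kn pav t0 tk) _.
have expo : n%:R * (2 * (theta * k%:R) ^+ 2) - theta * (n%:R * eps - k%:R) <=
    1 - n%:R * delta.
  have h : 2 * (theta * k%:R) ^+ 2 <= delta.
    have -> : 2 * (theta * k%:R) ^+ 2 = theta * (x / 2).
      by rewrite /theta; field; rewrite pnatr_eq0; lia.
    by rewrite /delta -mulrA ler_pM2l // ler_pM2r.
  have := ler_wpM2l (ler0n R n) h.
  have -> : theta * (n%:R * eps - k%:R) = 2 * (n%:R * delta) - theta * k%:R.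
    by rewrite /delta; field.
  lra.
have nd : 0 < n%:R * delta by rewrite mulr_gt0 // ltr0n.
have e1 : expR (n%:R * (2 * (theta * k%:R) ^+ 2) - theta * (n%:R * eps - k%:R)) <=
    expR 1 * (27 / (n%:R * delta) ^+ 3).
  apply: le_trans (_ : expR (1 - n%:R * delta) <= _); first by rewrite ler_expR.
  by rewrite expRD ler_pM2l ?expR_gt0 // inv_expR_le_cube.
set E := expR 1 in e1 *; have E0 : 0 < E by exact: expR_gt0.
apply: (@le_trans _ _ ((2 * n%:R * n.+1%:R * #|Av n perm231|%:R) *
    (2 * (E * (27 / (n%:R * delta) ^+ 3))))).
  by rewrite ler_pM ?exprn_ge0 ?mulr_ge0 ?expR_ge0 // ler_pM2l.
rewrite -(natr1 n); set N := n%:R in nR *; set A := #|_|%:R in Av0 *.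
have N0 : 0 < N by lra.
have -> : 2 * N * (N + 1) * A * (2 * (E * (27 / (N * delta) ^+ 3))) =
  (4 * E * (27 / delta ^+ 3) * A) * ((N + 1) / N ^+ 2).
  by field; rewrite !gt_eqF.
have -> : 16 * E * (27 / delta ^+ 3) * (N + 1)^-1 * A =
  (4 * E * (27 / delta ^+ 3) * A) * (4 / (N + 1)).
  by field; rewrite !gt_eqF //; lra.
rewrite ler_pM2l; last first.
  by rewrite !mulr_gt0 ?invr_gt0 ?exprn_gt0.
rewrite ler_pdivrMr ?exprn_gt0 // mulrAC ler_pdivlMr; last by lra.
rewrite -expr2 (_ : 4 = 2 ^+ 2); last by rewrite -natrX.
by rewrite -exprMn lerXn2r ?nnegrE; lra.
Qed.

End Concentration.

Theorem theorem1p8 (R : realType) (d : nat -> measure_display)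
    (T : forall n : nat, measurableType (d n))
    (P : forall n : nat, probability (T n) R)
    (sigma : forall n : nat, {RV (P n) >-> 'S_n})
    (sigma_uniform : forall n : nat, (0 < n)%N ->
       uniform_on (sigma n) (Av n perm231))
    (k : nat) (k_gt0 : (0 < k)%N) (p : 'S_k) (p_av : p \in Av k perm231) :
  cvg_in_probability P (fun n w => cocc_freq R p (sigma n w))
    (2 ^+ (LRMax p + RLMax p) / 2 ^+ (2 * k)).
Proof.
move=> eps eps0; have [K HK] := deviation_bound k_gt0 p_av eps0.
apply: (@squeeze_cvge _ _ _ _ (fun=> 0%E) _ (fun n => (K * n.+1%:R^-1)%:E)).
- near=> n; rewrite measure_ge0 /=.
  have kn : (k <= n)%N by near: n; exact: nbhs_infty_ge.
  have n0 : (0 < n)%N := leq_trans k_gt0 kn.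
  rewrite (uniform_on_preimage (fun s : 'S_n => eps < `|cocc_freq R p s -
    2 ^+ (LRMax p + RLMax p) / 2 ^+ (2 * k)|) (sigma_uniform n n0)).
  by rewrite lee_fin HK.
- exact: cvg_cst.
- apply: cvg_EFin; first by near=> n.
  rewrite -(mulr0 K); apply: cvgMr; exact: cvg_harmonic.
Unshelve. all: by end_near.
Qed.
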